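(* Let $(M,Q)$ be a Q-manifold. Then every $b$-closed cochain $\phi^n\in C^n(M,Q)$ (i.e. $b\phi^n=0$) satisfies $\phi^n\circ(Q\otimes\cdots\otimes Q)=0$; that is, $\phi^n(Q(f_0),Q(f_1),\dots,Q(f_n))=0$ for all $f_0,\dots,f_n\in C^\infty(M)$.
   Context: Supermanifolds are real smooth supermanifolds in the sense of Berezin--Leites; $C^\infty(M)$ is the supercommutative nuclear Fréchet algebra of global sections of the structure sheaf, and $\widetilde f\in\mathbb Z_2$ is the Grassmann parity of a homogeneous $f$. A Q-manifold $(M,Q)$ is a supermanifold with an odd vector field $Q$ satisfying $[Q,Q]=0$ (equivalently $Q^2=0$). Derived product: $f\star g := (-1)^{\widetilde f}Q(f)g$ (for homogeneous $f$, extended bilinearly), which is associative. Shifted parity: $\overline f:=\widetilde f+1$. $n$-cochains: $C^n(M,Q)$ is the super vector space of all (even and odd) continuous $\mathbb R$-linear maps $\phi^n: C^\infty(M)^{\widehat\otimes (n+1)}\to\mathbb R$ (completed projective tensor product), written $\phi^n(f_0,\dots,f_n)$. Hochschild coboundary $b:C^n(M,Q)\to C^{n+1}(M,Q)$ (formula for homogeneous arguments, extended linearly): $$(b\phi^n)(f_0,\dots,f_{n+1})=\sum_{i=0}^n(-1)^i\phi^n(f_0,\dots,f_i\star f_{i+1},\dots,f_{n+1})+(-1)^{n+1+\overline f_{n+1}(\overline f_0+\cdots+\overline f_n)}\phi^n(f_{n+1}\star f_0,f_1,\dots,f_n).$$ *)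

(* Defs.v *)
From HB Require Import structures.
From mathcomp Require Import all_boot all_order all_algebra.
From mathcomp Require Import all_classical all_reals all_analysis.

Set Implicit Arguments.
Unset Strict Implicit.
Unset Printing Implicit Defensive.

Import Order.TTheory GRing.Theory Num.Theory.
Import numFieldNormedType.Exports.

Local Open Scope classical_set_scope.
Local Open Scope ring_scope.

(* Supercommutative unital superalgebras over R.  The R-algebra structure is
   given by a ring morphism from R to the centre, so that scaling x by c is
   [alg_scalar c * x]; [algType] is not used because it excludes the zero
   algebra, which the sheaf axioms force on the empty set.  [part b] is the
   projection onto the homogeneous component of parity [b] ([false] is even,
   [true] is odd). *)
HB.mixin Record isSuperAlgebra (R : pzRingType) A of GRing.PzRing A := {
  alg_scalar : {rmorphism R -> A};
  alg_scalar_central : forall c (x : A), alg_scalar c * x = x * alg_scalar c;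
  part : bool -> A -> A;
  part_linear : forall b c (x y : A),
    part b (alg_scalar c * x + y) = alg_scalar c * part b x + part b y;
  part_part : forall a b (x : A),
    part a (part b x) = if a == b then part b x else 0;
  part_sum : forall x : A, part false x + part true x = x;
  part_mul : forall a b (x y : A),
    part (a (+) b) (part a x * part b y) = part a x * part b y;
  super_mulrC : forall a b (x y : A),
    part a x * part b y = (-1) ^+ (a && b) * (part b y * part a x)
}.

#[short(type="superAlgType")]
HB.structure Definition SuperAlgebra (R : pzRingType) :=
  {A of GRing.PzRing A & isSuperAlgebra R A}.

Definition scal (R : pzRingType) (A : superAlgType R) (c : R) (x : A) : A :=
  alg_scalar c * x.

Definition homogeneous (R : pzRingType) (A : superAlgType R) (b : bool)
  (x : A) : Prop := part b x = x.

Definition super_morphism (R : pzRingType) (A B : superAlgType R)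
    (h : A -> B) : Prop :=
  [/\ forall c x y, h (scal c x + y) = scal c (h x) + h y,
      h 1 = 1,
      forall x y, h (x * y) = h x * h y
    & forall b x, h (part b x) = part b (h x)].

Record opens (T : topologicalType) := Opens {
  open_set :> set T;
  open_setP : open open_set
}.

Definition opensT (T : topologicalType) : opens T := Opens openT.

Definition opensI (T : topologicalType) (U V : opens T) : opens T :=
  Opens (openI (open_setP U) (open_setP V)).

Lemma opensIl (T : topologicalType) (U V : opens T) : opensI U V `<=` U.
Proof. exact: subIsetl. Qed.

Lemma opensIr (T : topologicalType) (U V : opens T) : opensI U V `<=` V.
Proof. exact: subIsetr. Qed.

Lemma opens_subT (T : topologicalType) (U : opens T) : U `<=` opensT T.
Proof. exact: subsetT. Qed.

Record superspace (R : realType) := Superspace {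
  body :> topologicalType;
  sec : opens body -> superAlgType R;
  res : forall U V : opens body, V `<=` U -> sec U -> sec V;
  res_morphism : forall (U V : opens body) (VU : V `<=` U),
    super_morphism (res VU);
  res_id : forall (U : opens body) (UU : U `<=` U) (f : sec U), res UU f = f;
  res_comp : forall (U V W : opens body) (VU : V `<=` U) (WV : W `<=` V)
      (WU : W `<=` U) (f : sec U),
    res WV (res VU f) = res WU f;
  sheaf_separated : forall (I : Type) (U : opens body) (V : I -> opens body)
      (VU : forall i, V i `<=` U),
    U `<=` \bigcup_i V i ->
    forall f g : sec U, (forall i, res (VU i) f = res (VU i) g) -> f = g;
  sheaf_gluing : forall (I : Type) (U : opens body) (V : I -> opens body)
      (VU : forall i, V i `<=` U),
    U `<=` \bigcup_i V i ->
    forall s : (forall i, sec (V i)),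
      (forall i j, res (@opensIl _ (V i) (V j)) (s i) =
                   res (@opensIr _ (V i) (V j)) (s j)) ->
      exists f : sec U, forall i, res (VU i) f = s i
}.

Section LocalModel.
Context {R : realType}.

(* The Grassmann algebra on q generators: [a I] is the coefficient of the
   product of the generators xi_i, i in I, taken in increasing order. *)
Definition grassmann (q : nat) := {ffun {set 'I_q} -> R}.

Definition inversions q (I J : {set 'I_q}) : nat :=
  #|[set ij : 'I_q * 'I_q | [&& ij.1 \in I, ij.2 \in J & (ij.2 < ij.1)%N]]|.

Definition grassmann_mul q (a b : grassmann q) : grassmann q :=
  [ffun S => \sum_(I in powerset S)
     (-1) ^+ inversions I (S :\: I)%SET * a I * b (S :\: I)%SET].

Definition grassmann_one q : grassmann q := [ffun S => (S == finset.set0)%:R].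

Definition grassmann_part q (b : bool) (a : grassmann q) : grassmann q :=
  [ffun S : {set 'I_q} => if odd #|S| == b then a S else 0].

Definition partials p (s : seq 'I_p) (f : 'rV[R]_p -> R) : 'rV[R]_p -> R :=
  foldr (fun i g => 'D_(delta_mx 0 i : 'rV[R]_p) g) f s.

(* Smoothness on the open set W; the values of f outside W are irrelevant. *)
Definition smooth_on p (W : set 'rV[R]_p) (f : 'rV[R]_p -> R) : Prop :=
  forall s x, W x ->
    {for x, continuous (partials s f)} /\
    forall i, derivable (partials s f) x (delta_mx 0 i).

End LocalModel.
Arguments grassmann : clear implicits.

(* An isomorphism of an open part of M with a superdomain in R^{p|q}: a
   homeomorphism [chart_map] from the open set [chart_dom] onto an open subset
   of R^p, and, for each open U in [chart_dom], an isomorphism [coeff] from the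
   sections over U to C^oo(chart_map(U)) (x) Grassmann(q), compatible with
   restrictions.  An element of C^oo(W) (x) Grassmann(q) is represented by a
   function on R^p taken up to equality on W. *)
Record chart (R : realType) (M : superspace R) (p q : nat) := Chart {
  chart_dom : opens M;
  chart_map : M -> 'rV[R]_p;
  chart_inj : set_inj chart_dom chart_map;
  chart_continuous : forall m, open_set chart_dom m -> {for m, continuous chart_map};
  chart_open : forall U : opens M, U `<=` chart_dom -> open (chart_map @` U);
  coeff : forall U : opens M, U `<=` chart_dom ->
    sec U -> 'rV[R]_p -> grassmann R q;
  coeff_smooth : forall (U : opens M) (Ud : U `<=` chart_dom) (f : sec U) I,
    smooth_on (chart_map @` U) (fun x => coeff Ud f x I);
  coeff_injective : forall (U : opens M) (Ud : U `<=` chart_dom) (f g : sec U),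
    (forall x, (chart_map @` U) x -> coeff Ud f x = coeff Ud g x) -> f = g;
  coeff_surjective : forall (U : opens M) (Ud : U `<=` chart_dom)
      (F : 'rV[R]_p -> grassmann R q),
    (forall I, smooth_on (chart_map @` U) (fun x => F x I)) ->
    exists f : sec U, forall x, (chart_map @` U) x -> coeff Ud f x = F x;
  coeff_linear : forall (U : opens M) (Ud : U `<=` chart_dom) (c : R)
      (f g : sec U) x, (chart_map @` U) x ->
    forall I, coeff Ud (scal c f + g) x I = c * coeff Ud f x I + coeff Ud g x I;
  coeff_one : forall (U : opens M) (Ud : U `<=` chart_dom) x,
    (chart_map @` U) x -> coeff Ud 1 x = grassmann_one q;
  coeff_mul : forall (U : opens M) (Ud : U `<=` chart_dom) (f g : sec U) x,
    (chart_map @` U) x ->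
    coeff Ud (f * g) x = grassmann_mul (coeff Ud f x) (coeff Ud g x);
  coeff_part : forall (U : opens M) (Ud : U `<=` chart_dom) b (f : sec U) x,
    (chart_map @` U) x -> coeff Ud (part b f) x = grassmann_part b (coeff Ud f x);
  coeff_res : forall (U V : opens M) (Ud : U `<=` chart_dom)
      (Vd : V `<=` chart_dom) (VU : V `<=` U) (f : sec U) x,
    (chart_map @` V) x -> coeff Vd (res VU f) x = coeff Ud f x
}.

Record supermanifold (R : realType) (p q : nat) := Supermanifold {
  superspace_of :> superspace R;
  body_hausdorff : hausdorff_space superspace_of;
  body_second_countable : @second_countable superspace_of;
  atlas : forall m : superspace_of,
    exists c : chart superspace_of p q, open_set (chart_dom c) m
}.

Definition Cinf (R : realType) p q (M : supermanifold R p q) : superAlgType R :=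
  @sec R M (opensT M).

Section SmoothTopology.
Context (R : realType) (p q : nat) (M : supermanifold R p q).

Definition chart_compacts (c : chart M p q) : set (set 'rV[R]_p) :=
  [set K | compact K /\ K `<=` chart_map c @` chart_dom c].

Definition jet_index := (chart M p q * {set 'I_q} * seq 'I_p)%type.

Definition jet_space (i : jet_index) : topologicalType :=
  {family chart_compacts i.1.1, 'rV[R]_p -> R}.

Definition jet (f : Cinf M) : prod_topology jet_space :=
  fun i => partials i.2
    (fun x => coeff (@subset_refl _ (chart_dom i.1.1))
                (res (@opens_subT _ (chart_dom i.1.1)) f) x i.1.2).

(* The Frechet topology of C^oo(M): uniform convergence, on compact subsets of
   each chart, of all partial derivatives of all Grassmann coefficients. *)
Definition CinfTop : topologicalType := initial_topology jet.

End SmoothTopology.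

(* Vector fields of parity [a]: homogeneous derivations of the structure
   sheaf. *)
Record vector_field (R : realType) p q (M : supermanifold R p q) (a : bool) :=
  VectorField {
  vf :> forall U : opens M, sec U -> sec U;
  vf_linear : forall U (c : R) (f g : sec U),
    vf (scal c f + g) = scal c (vf f) + vf g;
  vf_parity : forall U b (f : sec U),
    homogeneous b f -> homogeneous (a (+) b) (vf f);
  vf_leibniz : forall U b (f g : sec U), homogeneous b f ->
    vf (f * g) = vf f * g + (-1) ^+ (a && b) * (f * vf g);
  vf_res : forall (U V : opens M) (VU : V `<=` U) (f : sec U),
    vf (res VU f) = res VU (vf f)
}.

Definition bracket (R : realType) p q (M : supermanifold R p q) (a b : bool)
    (X : vector_field M a) (Y : vector_field M b) (U : opens M) (f : sec U) :
    sec U :=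
  X U (Y U f) - (-1) ^+ (a && b) * Y U (X U f).

Record Qmanifold (R : realType) (p q : nat) := QManifold {
  Qmanifold_space :> supermanifold R p q;
  Qfield : vector_field Qmanifold_space true;
  Qfield_homological : forall (U : opens Qmanifold_space) (f : sec U),
    bracket Qfield Qfield f = 0
}.

(* The completed projective tensor power is characterised by the fact that
   restriction to decomposable tensors identifies its continuous linear forms
   with the jointly continuous multilinear forms. *)
Record cochain (R : realType) p q (M : Qmanifold R p q) (n : nat) := Cochain {
  cochain_fun :> ('I_n.+1 -> Cinf M) -> R;
  cochain_linear : forall (i : 'I_n.+1) (f : 'I_n.+1 -> Cinf M) (c : R)
      (u v : Cinf M),
    cochain_fun (dfwith f i (scal c u + v)) =
    c * cochain_fun (dfwith f i u) + cochain_fun (dfwith f i v);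
  cochain_continuous :
    continuous (cochain_fun : {ptws 'I_n.+1 -> CinfTop M} -> R)
}.

Section Hochschild.
Context (R : realType) (p q : nat) (M : Qmanifold R p q).
Implicit Types (n : nat) (f g : Cinf M).

Definition Q f : Cinf M := Qfield M (opensT M) f.

Definition star f g : Cinf M :=
  \sum_(a : bool) (-1) ^+ a * (Q (part a f) * g).

(* (f_0, ..., f_i * f_{i+1}, ..., f_{n+1}) *)
Definition face n (F : 'I_n.+2 -> Cinf M) (i : 'I_n.+1) (j : 'I_n.+1) :
    Cinf M :=
  let left_of k := F (widen_ord (leqnSn n.+1) k) in
  let right_of k := F (lift ord0 k) in
  if (j < i)%N then left_of j
  else if j == i then star (left_of i) (right_of i)
  else right_of j.

(* (f_{n+1} * f_0, f_1, ..., f_n) *)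
Definition cyclic_face n (F : 'I_n.+2 -> Cinf M) (j : 'I_n.+1) : Cinf M :=
  if j == ord0 then star (F ord_max) (F ord0)
  else F (widen_ord (leqnSn n.+1) j).

(* The coboundary on arguments F_j homogeneous of parity [e j]; the shifted
   parity of F_j is then [~~ e j]. *)
Definition coboundary_homogeneous n (e : 'I_n.+2 -> bool)
    (phi : ('I_n.+1 -> Cinf M) -> R) (F : 'I_n.+2 -> Cinf M) : R :=
  \sum_(i < n.+1) (-1) ^+ i * phi (face F i)
  + (-1) ^+ (n.+1 + ~~ e ord_max *
              \sum_(j < n.+1) ~~ e (widen_ord (leqnSn n.+1) j))
    * phi (cyclic_face F).

(* Linear extension of the homogeneous formula: every argument is split into
   its even and odd components. *)
Definition coboundary n (phi : ('I_n.+1 -> Cinf M) -> R)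
    (F : 'I_n.+2 -> Cinf M) : R :=
  \sum_(e : {ffun 'I_n.+2 -> bool})
    coboundary_homogeneous e phi (fun j => part (e j) (F j)).

End Hochschild.

(* Main.v *)
Require Import Defs.
From mathcomp Require Import all_boot all_order all_algebra.
From mathcomp Require Import all_classical all_reals all_analysis.

Import GRing.Theory.
Local Open Scope ring_scope.

(** Since Q(1) = 0 and Q^2 = 0, we have star 1 g = 0 and star (Q h) g = 0 for the
    derived product, whereas star f 1 = (-1)^f Q(f).  Hence every term of
    (b phi)(f_0, 1, Q(f_1), ..., Q(f_n)) vanishes except the first one, which
    is phi(Q(f_0), Q(f_1), ..., Q(f_n)) up to sign.  Multilinearity reduces
    the claim to homogeneous f_i. *)

Lemma dfwith_self {I : eqType} {T : Type} (f : I -> T) (i : I) :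
  dfwith f i (f i) = f.
Proof. by apply/funext => j; case: dfwithP. Qed.

Section SuperAlgebra.
Context {R : pzRingType} {A : superAlgType R}.
Implicit Types x y : A.

Lemma scal1r x : scal 1 x = x.
Proof. by rewrite /scal rmorph1 mul1r. Qed.

Lemma partD b x y : part b (x + y) = part b x + part b y.
Proof. by have := part_linear b 1 x y; rewrite rmorph1 !mul1r. Qed.

Lemma part0 b : part b (0 : A) = 0.
Proof. by apply: (@addrI _ (part b 0)); rewrite -partD !addr0. Qed.

Lemma partN b x : part b (- x) = - part b x.
Proof. by apply: (@addrI _ (part b x)); rewrite -partD !subrr part0. Qed.

Lemma homogeneous_part b x : homogeneous b (part b x).
Proof. by rewrite /homogeneous part_part eqxx. Qed.

Lemma part_homogeneous a b x :
  homogeneous b x -> part a x = if a == b then x else 0.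
Proof. by rewrite /homogeneous => hx; rewrite -{1}hx part_part hx. Qed.

Lemma homogeneous_signM (a b : bool) x :
  homogeneous b x -> homogeneous b ((-1) ^+ a * x).
Proof.
rewrite /homogeneous => hx.
by case: a; rewrite ?mulN1r ?mul1r ?partN hx.
Qed.

(** Evenness of the unit is derived from the product rules. With [1 = e + o], the odd part of
    [e * 1 = e] gives [e * o = 0], the odd part of [o * 1 = o] gives [o * e = o], and
    supercommutativity forces [o = 0]. *)
Lemma homogeneous1 : homogeneous false (1 : A).
Proof.
set e : A := part false 1; set o : A := part true 1.
have eo : e + o = 1 by exact: part_sum.
have he : e * e + e * o = e by rewrite -mulrDr eo mulr1.
have ho : o * e + o * o = o by rewrite -mulrDr eo mulr1.
have Eeo : part true (e * o) = e * o by exact: (part_mul false true).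
have Eoe : part true (o * e) = o * e by exact: (part_mul true false).
have Eee : part false (e * e) = e * e by exact: (part_mul false false).
have Eoo : part false (o * o) = o * o by exact: (part_mul true true).
have eo0 : e * o = 0.
  have := congr1 (part true) he.
  by rewrite partD Eeo -Eee !part_part /= add0r.
have oeo : o * e = o.
  have := congr1 (part true) ho.
  by rewrite partD Eoe -Eoo !part_part /= addr0.
have o0 : o = 0.
  by rewrite -oeo (super_mulrC true false) /= expr0 mul1r eo0.
by rewrite /homogeneous -[RHS]eo o0 addr0.
Qed.

Lemma multiadditive_eq0 (n : nat) (V : nmodType) (psi : ('I_n -> A) -> V) :
  (forall (i : 'I_n) (f : 'I_n -> A) (u v : A),
    psi (dfwith f i (u + v)) = psi (dfwith f i u) + psi (dfwith f i v)) ->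
  (forall (e : 'I_n -> bool) (f : 'I_n -> A),
    (forall i, homogeneous (e i) (f i)) -> psi f = 0) ->
  forall f, psi f = 0.
Proof.
move=> psiD psi0 f.
(* Only the slots below [k] may be inhomogeneous: [k = n] imposes no condition, [k = 0] is the
   homogeneous case. The induction step splits slot [k] into its even and odd parts. *)
suff H k (g : 'I_n -> A) : (forall i : 'I_n, (k <= i)%N -> exists b, homogeneous b (g i)) ->
    psi g = 0.
  by apply: (H n) => i; rewrite leqNgt ltn_ord.
elim: k g => [|k IH] g hg.
  have [e he] := choice (fun i => hg i isT).
  exact: psi0 he.
have [kn|nk] := ltnP k n; last first.
  by apply: IH => i ki; have := leq_trans nk ki; rewrite leqNgt ltn_ord.
pose i := Ordinal kn.
rewrite -(dfwith_self g i) -(part_sum (g i)) psiD.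
have part_eq0 b : psi (dfwith g i (part b (g i))) = 0.
  apply: IH => j kj; have [<-|ij] := eqVneq i j.
    by rewrite dfwithin; exists b; exact: homogeneous_part.
  by rewrite dfwithout //; apply: hg; rewrite ltn_neqAle kj andbT.
by rewrite !part_eq0 addr0.
Qed.

End SuperAlgebra.

Section DerivedProduct.
Context {R : realType} {p q : nat} {M : Qmanifold R p q}.
Implicit Types f g : Cinf M.

Lemma QD f g : Q (f + g) = Q f + Q g.
Proof.
by have := vf_linear (Qfield M) (U := opensT M) 1 f g; rewrite !scal1r.
Qed.

Lemma Q0 : Q (0 : Cinf M) = 0.
Proof. by apply: (@addrI _ (Q 0)); rewrite -QD !addr0. Qed.

Lemma QN f : Q (- f) = - Q f.
Proof. by apply: (@addrI _ (Q f)); rewrite -QD !subrr Q0. Qed.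

Lemma Q_homogeneous b f : homogeneous b f -> homogeneous (~~ b) (Q f).
Proof. exact: (vf_parity (Qfield M) (U := opensT M)). Qed.

(** Oddness of [Q] swaps the two parity components. Since [star] splits its left factor by parity,
    this is what makes [star f g] vanish when [Q f = 0]. *)
Lemma Q_part b f : Q (part b f) = part (~~ b) (Q f).
Proof.
have h c := part_homogeneous (~~ b) _ _ (Q_homogeneous c _ (homogeneous_part c f)).
rewrite -[in RHS](part_sum f) QD partD !h.
by case: b {h} => /=; rewrite ?add0r ?addr0.
Qed.

Lemma Q1 : Q (1 : Cinf M) = 0.
Proof.
have := vf_leibniz (Qfield M) (U := opensT M) 1 homogeneous1.
rewrite !mulr1 expr0 !mul1r => h.
by apply: (@addrI _ (Q 1)); rewrite addr0; exact: esym h.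
Qed.

Lemma QQ f : Q (Q f) = 0.
Proof.
have := Qfield_homological f.
(* For an odd field the self-bracket is [Q (Q f) + Q (Q f)]; the factor 2 is then inverted in
   [R]. *)
rewrite /bracket /= expr1 mulN1r opprK -/(Q f) -/(Q (Q f)) => h.
have : scal (2^-1 : R) (Q (Q f) + Q (Q f)) = 0 by rewrite h /scal mulr0.
rewrite /scal mulrDr -mulrDl -rmorphD /=.
have -> : 2^-1 + 2^-1 = 1 :> R by rewrite [RHS]Num.Theory.splitr !div1r.
by rewrite rmorph1 mul1r.
Qed.

Lemma star_eq0l f g : Q f = 0 -> star f g = 0.
Proof.
by move=> Qf; rewrite /star big1 // => a _; rewrite Q_part Qf part0 mul0r mulr0.
Qed.

Lemma star_eq0r f : star f 0 = 0.
Proof. by rewrite /star big1 // => a _; rewrite !mulr0. Qed.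

Lemma star_homogeneous1 b f : homogeneous b f -> star f 1 = (-1) ^+ b * Q f.
Proof.
move=> hf; rewrite /star big_bool /= !mulr1 !(part_homogeneous _ _ _ hf).
by case: b {hf} => /=; rewrite Q0 mulr0 ?addr0 ?add0r.
Qed.

End DerivedProduct.

Section Cochains.
Context {R : realType} {p q : nat} {M : Qmanifold R p q} {n : nat}.
Context (phi : cochain M n).

Lemma cochainD (i : 'I_n.+1) (f : 'I_n.+1 -> Cinf M) (u v : Cinf M) :
  phi (dfwith f i (u + v)) = phi (dfwith f i u) + phi (dfwith f i v).
Proof. by have := cochain_linear phi i f 1 u v; rewrite scal1r mul1r. Qed.

Lemma cochain_eq0 (f : 'I_n.+1 -> Cinf M) (i : 'I_n.+1) : f i = 0 -> phi f = 0.
Proof.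
move=> fi; apply: (@addrI _ (phi f)).
(* The zero entry is read as [0 + 0], so additivity gives [phi f + phi f = phi f]. *)
by rewrite addr0 -{1 2}(dfwith_self f i) -cochainD fi addr0 -{1}fi dfwith_self.
Qed.

(** A zero argument either survives as an entry of the face or is a factor of the product in slot
    0. *)
Lemma face0_eq0 (F : 'I_n.+2 -> Cinf M) (k : 'I_n.+2) :
  F k = 0 -> phi (face F ord0) = 0.
Proof.
move=> Fk; case: (unliftP ord0 k) Fk => [j|] -> Fj.
- apply: (cochain_eq0 _ j); rewrite /face ltn0 Fj.
  by case: eqP => // j0; rewrite -j0 Fj star_eq0r.
- apply: (cochain_eq0 _ ord0); rewrite /face ltn0 eqxx.
  have -> : widen_ord (leqnSn n.+1) ord0 = ord0 by exact: val_inj.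
  by rewrite Fj star_eq0l ?Q0.
Qed.

(** Every other face contains a product whose left factor is some [F k] with [k] nonzero: [F i] for
    the inner faces, the last argument for the cyclic one. These factors are killed by [Q], so the
    parity-dependent cyclic sign never matters. *)
Lemma coboundary_homogeneous_face0 (e : 'I_n.+2 -> bool)
    (F : 'I_n.+2 -> Cinf M) :
  (forall k, k != ord0 -> Q (F k) = 0) ->
  coboundary_homogeneous e phi F = phi (face F ord0).
Proof.
move=> QF; rewrite /coboundary_homogeneous [X in X + _]big_ord_recl.
rewrite /= expr0 mul1r [X in _ + X + _]big1 ?addr0.
  rewrite (cochain_eq0 (cyclic_face F) ord0) ?mulr0 ?addr0 //.
  by rewrite /cyclic_face eqxx star_eq0l ?QF.
move=> i _; rewrite (cochain_eq0 _ (lift ord0 i)) ?mulr0 //.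
by rewrite /face ltnn eqxx star_eq0l ?QF.
Qed.

Lemma coboundary_face0 (e : 'I_n.+2 -> bool) (F : 'I_n.+2 -> Cinf M) :
  (forall k, homogeneous (e k) (F k)) ->
  (forall k, k != ord0 -> Q (F k) = 0) ->
  coboundary phi F = phi (face F ord0).
Proof.
move=> hF QF; rewrite /coboundary.
under eq_bigr => e' _.
  rewrite coboundary_homogeneous_face0; first over.
  by move=> k k0; rewrite Q_part QF // part0.
rewrite (bigD1 (finfun e)) //= big1 ?addr0.
  by congr (phi (face _ _)); apply/funext => k; rewrite ffunE hF.
(* A parity pattern other than [e] differs from it at some [k], where the selected component of
   [F k] is zero. *)
move=> e' e'e.
have [k ek] : exists k, e' k != e k.
  apply/existsP; apply: contraNT e'e => /existsPn e'e.
  by apply/eqP/ffunP => k; rewrite ffunE; apply/eqP/negPn.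
by apply: (face0_eq0 _ k); rewrite (part_homogeneous _ _ _ (hF k)) (negPf ek).
Qed.

Lemma closed_cochain_homogeneous (e : 'I_n.+1 -> bool) (f : 'I_n.+1 -> Cinf M) :
  (forall F : 'I_n.+2 -> Cinf M, coboundary phi F = 0) ->
  (forall i, homogeneous (e i) (f i)) ->
  phi (fun i => Q (f i)) = 0.
Proof.
move=> closed hf.
(* [F] is the tuple [f 0, 1, Q (f 1), ..., Q (f n)] with a sign on its first entry, and [d] lists
   its parities. The sign cancels the one in [star_homogeneous1], so slot 0 of the zeroth face is
   exactly [Q (f 0)]. *)
pose F k : Cinf M := if unlift ord0 k is Some j
  then (if j == ord0 then 1 else Q (f j)) else (-1) ^+ e ord0 * f ord0.
pose d k := if unlift ord0 k is Some j
  then (if j == ord0 then false else ~~ e j) else e ord0.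
have -> : (fun i => Q (f i)) = face F ord0.
  apply/funext => j; rewrite /face ltn0.
  have -> : widen_ord (leqnSn n.+1) ord0 = ord0 by exact: val_inj.
  rewrite /F unlift_none !liftK eqxx.
  have [->|//] := eqVneq j ord0.
  rewrite (star_homogeneous1 (e ord0)); last exact: homogeneous_signM.
  by case: (e ord0); rewrite ?expr0 ?expr1 ?mulN1r ?QN ?mul1r ?opprK.
rewrite -(coboundary_face0 d) //.
- move=> k; rewrite /F /d; case: unlift => [j|]; last exact: homogeneous_signM.
  by case: eqP => _; [exact: homogeneous1|exact: Q_homogeneous].
- move=> k; rewrite /F; case: unliftP => [j _ _|->]; last by rewrite eqxx.
  by case: eqP => _; [exact: Q1|exact: QQ].
Qed.

End Cochains.

Theorem proposition3p3 (R : realType) (p q n : nat) (M : Qmanifold R p q)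
    (phi : cochain M n)
    (closed : forall F : 'I_n.+2 -> Cinf M, coboundary phi F = 0)
    (f : 'I_n.+1 -> Cinf M) :
  phi (fun i => Q (f i)) = 0.
Proof.
apply: (@multiadditive_eq0 _ (Cinf M) _ R
  (fun g => phi (fun i => Q (g i))) _ _ f) => [i g u v|e g].
(* Applying [Q] entrywise commutes with replacing one entry, so additivity of [phi] passes to its
   composite with [Q]. *)
- have Q_dfwith w : (fun j => Q (dfwith g i w j)) = dfwith (fun j => Q (g j)) i (Q w).
    apply/funext => j.
    have [<-|ij] := eqVneq i j; first by rewrite !dfwithin.
    by rewrite !dfwithout.
  by rewrite !Q_dfwith QD cochainD.
- exact: closed_cochain_homogeneous.
Qed.
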